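(* Let $H$ be an $m\times m$ Hermitian matrix and let $u,v\in\{1,\ldots,m\}$ be distinct. The following are equivalent. 1. $u$ and $v$ are strongly cospectral with respect to $H$. 2. $u$ and $v$ are cospectral and parallel with respect to $H$. 3. $\phi_u(H,t)=\phi_v(H,t)$ and the poles of $\dfrac{\phi_S(H,t)}{\phi(H,t)}$ are simple, where $S=\{u,v\}$.
   Context: Write $H=\sum_j\lambda_jE_j$ for the spectral decomposition of $H$, where the $\lambda_j$ are the distinct eigenvalues and $E_j$ is the orthogonal projection onto the eigenspace of $\lambda_j$. $\mathbf{e}_u$ is the standard basis vector indexed by $u$. With respect to $H$, columns $u,v$ are: cospectral if $(E_j)_{u,u}=(E_j)_{v,v}$ for each $j$; parallel if for each $j$ there exists $c\in\mathbb{C}$ with $E_j\mathbf{e}_u=cE_j\mathbf{e}_v$; strongly cospectral if for each $j$ there exists $c\in\mathbb{C}$ with $|c|=1$ and $E_j\mathbf{e}_u=cE_j\mathbf{e}_v$. $\phi(H,t)=\det(tI-H)$; for $S\subseteq\{1,\ldots,m\}$, $\phi_S(H,t)$ is the determinant of the matrix obtained from $tI-H$ by deleting the rows and columns indexed by $S$ (an empty determinant equals $1$), and $\phi_u:=\phi_{\{u\}}$. *)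

(* Defs.v *)
From mathcomp Require Import all_boot all_order all_algebra.

Set Implicit Arguments.
Unset Strict Implicit.
Unset Printing Implicit Defensive.

Import Order.TTheory GRing.Theory Num.Theory.
Local Open Scope ring_scope.
Local Open Scope sesquilinear_scope.

(* The complex field is an arbitrary [C : numClosedFieldType], as in
   [spectral]; [R[i]] for [R : realType] is an instance. *)

Section Spectral.
Variables (C : numClosedFieldType) (m : nat).
Implicit Types (H : 'M[C]_m) (a : C) (u v : 'I_m).

(* [eigenspace] and [proj_ortho] act on row vectors, whence the transpositions:
   [eigenproj H a] acts on column vectors, as the orthogonal projection onto
   {x | H x = a x}; see [eigenproj_idem], [eigenproj_hermsym] and
   [eigenproj_fixP]. *)
Definition eigenproj H a : 'M[C]_m := (proj_ortho (eigenspace H^T a))^T.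

Lemma eigenproj_idem H a : eigenproj H a *m eigenproj H a = eigenproj H a.
Proof. by rewrite /eigenproj -trmx_mul proj_ortho_proj. Qed.

Lemma eigenproj_fixP H a (x : 'cV[C]_m) :
  H *m x = a *: x <-> eigenproj H a *m x = x.
Proof.
split=> [Hx | <-].
  apply: trmx_inj; rewrite trmx_mul trmxK proj_ortho_id //.
  by apply/eigenspaceP; rewrite -trmx_mul Hx linearZ.
apply: trmx_inj; rewrite !trmx_mul trmxK linearZ /= trmx_mul trmxK.
exact/eigenspaceP/proj_ortho_sub.
Qed.

Lemma eigenproj_hermsym H a : eigenproj H a \is hermsymmx.
Proof.
pose P := proj_ortho (eigenspace H^T a).
have tcK (A : 'M[C]_m) : A ^t* ^t* = A.
  by apply/matrixP=> i j; rewrite !mxE conjCK.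
have PPh : P *m P ^t* = P ^t*.
  have := proj_ortho_compl_sub (eigenspace H^T a) 1%:M.
  rewrite mul1mx -(eqmx_ortho _ (proj_orthoE _)) => /orthomx1P/eqP.
  by rewrite mulmxBl mul1mx subr_eq0 => /eqP.
have Ph : P ^t* = P.
  move: P PPh => {}P PPh; rewrite -[RHS]tcK -[in RHS]PPh trmx_mul map_mxM.
  by rewrite -[LHS]PPh; congr (_ *m _); rewrite [RHS]tcK.
apply/is_hermitianmxP; rewrite expr0 scale1r /eigenproj -/P trmxK.
by rewrite -{1}Ph map_trmx trmxK.
Qed.

(* By [eigenvalue_root_char] the row eigenvalues tested by [eigenvalue] are the
   column ones. *)
Definition cospectral H u v :=
  forall a, eigenvalue H a -> eigenproj H a u u = eigenproj H a v v.

Definition parallel H u v :=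
  forall a, eigenvalue H a -> exists c : C,
    eigenproj H a *m delta_mx u 0 = c *: (eigenproj H a *m delta_mx v 0)
    :> 'cV[C]_m.

Definition strongly_cospectral H u v :=
  forall a, eigenvalue H a -> exists2 c : C, `|c| = 1 &
    eigenproj H a *m delta_mx u 0 = c *: (eigenproj H a *m delta_mx v 0)
    :> 'cV[C]_m.

(* Deletes the rows and columns indexed by S from tI - H. *)
Definition char_poly_del H (S : {set 'I_m}) : {poly C} :=
  \det (mxsub (@enum_val _ (mem (~: S))) (@enum_val _ (mem (~: S)))
          (char_poly_mx H)).

End Spectral.

Section Poles.
Variable C : fieldType.

(* f = g / (t - a)^k, where k > 0 and the rational function g = p / q is
   regular and nonzero at a. *)
Definition pole_of_order (f : {fraction {poly C}}) (a : C) (k : nat) :=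
  (0 < k)%N /\ exists p q : {poly C},
    [/\ ~~ root p a, ~~ root q a & f = tofrac p / tofrac (('X - a%:P) ^+ k * q)].

Definition simple_poles (f : {fraction {poly C}}) :=
  forall a k, pole_of_order f a k -> k = 1%N.

End Poles.

(* Main.v *)
Require Import Defs.
From mathcomp Require Import all_boot all_order all_algebra.
From mathcomp Require Import perm ring.
Import GRing.Theory Num.Theory.
Local Open Scope ring_scope.

Set Implicit Arguments.
Unset Strict Implicit.
Unset Printing Implicit Defensive.

(** Write E_a for the projection onto the eigenspace of a, phi = det(tI - H),
psi = prod_a (t - a) over the distinct eigenvalues, and L_a = psi / (t - a).
The spectral theorem says that the E_a sum to the identity, so that
B = sum_a L_a E_a is a polynomial matrix with (tI - H) B = psi I: B / psi is
the resolvent of H ([mul_char_poly_resolvent]).  The value of B at an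
eigenvalue a is the nonzero multiple L_a(a) E_a ([horner_resolvent_num]), which makes the
minors of B carry the information about each E_a separately.

Jacobi's identity for complementary minors ([jacobi_compl]) turns minors of B
into the polynomials phi_S:
  phi * B_uu = psi * phi_u  and
  phi * (B_uu B_vv - B_uv B_vu) = psi^2 * phi_{u,v}.
By the first equation, phi_u = phi_v iff B_uu = B_vv, iff all the (E_a)_uu and
(E_a)_vv agree ([char_poly_del1_eqP]).  By the second, phi_{u,v} / phi is the
2 x 2 minor of B divided by psi^2.  As psi has simple roots only, the poles
are simple iff that minor vanishes at every eigenvalue, that is, iff
(E_a)_uu (E_a)_vv = (E_a)_uv (E_a)_vu for all a ([simple_poles_del2P]).

Since E_a is a Hermitian idempotent, (E_a)_uv is the inner product of the
columns E_a e_u and E_a e_v.  The last equation is therefore the equality case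
of Cauchy-Schwarz, which means that the two columns are parallel; cospectrality
says that they have the same length, and a scalar between vectors of the same
nonzero length has modulus one ([hermsym_idem_cauchy]). *)

(** * Simple poles of a quotient with squared denominator *)

Section Poles.
Variable F : fieldType.
Implicit Types (p q r d : {poly F}) (a : F).

(** The quotient p / q is studied through its other expression d / r^2, where r
is squarefree: at a root of r the order is two unless d cancels a factor. *)
Lemma simple_poles_over_sqrP p q d r :
    q != 0 -> r != 0 -> q * d = r ^+ 2 * p ->
    (forall a, root r a -> exists2 l, r = ('X - a%:P) * l & ~~ root l a) ->
  simple_poles (tofrac p / tofrac q) <-> forall a, root r a -> root d a.
Proof.
move=> q0 r0 qd sqf.
have XM a (x y : {poly F}) : ('X - a%:P) * x = ('X - a%:P) * y -> x = y.
  by apply: mulfI; rewrite polyXsubC_eq0.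
split=> [sp a ra | rd a k [k_gt0 [x [y [xa ya]]]]].
  (* If d did not vanish at a, then d / ((t - a)^2 l^2) would show a pole of
     order two. *)
  case: (sqf a ra) => l rE la; apply/negPn/negP => da.
  suff: 2%N = 1%N by [].
  apply: (sp a); split=> //; exists d, (l ^+ 2).
  rewrite da /root horner_exp expf_eq0 /= -/(root l a) la; split=> //.
  rewrite -exprMn -rE; apply/eqP; rewrite eqr_div ?tofrac_eq0 ?expf_neq0 //.
  by rewrite -!tofracM tofrac_eq [p * _]mulrC [d * _]mulrC qd.
have [y0 Xk0]: y != 0 /\ ('X - a%:P) ^+ k != 0.
  rewrite expf_neq0 ?polyXsubC_eq0 //; split=> //.
  by apply: contraNneq ya => ->; rewrite root0.
move/eqP; rewrite eqr_div ?tofrac_eq0 ?mulf_neq0 // -!tofracM tofrac_eq => /eqP e.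
have {}e : d * (('X - a%:P) ^+ k * y) = r ^+ 2 * x.
  apply: (mulfI q0); rewrite mulrA qd -mulrA e; ring.
case: k k_gt0 Xk0 e => // k _ _ e.
(* As k > 0, evaluation at a leaves r(a)^2 x(a) = 0. *)
have ra : root r a.
  have /(congr1 (horner^~ a)) := e.
  rewrite /= !(hornerM, horner_exp) hornerXsubC subrr expr0n mul0r mulr0 => /esym/eqP.
  by rewrite !mulf_eq0 -[x.[a] == 0]/(root x a) (negPf xa) orbF orbb.
case: (sqf a ra) => l rE la.
have /factor_theorem[d' dE] := rd a ra.
have {}e : d' * ('X - a%:P) ^+ k * y = l ^+ 2 * x.
  apply: (XM a); apply: (XM a).
  transitivity (d * (('X - a%:P) ^+ k.+1 * y)); first by rewrite dE exprS; ring.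
  by rewrite e rE; ring.
(* If k were still positive here, the left side would vanish at a but not the
   right side. *)
case: k e => // k /(congr1 (horner^~ a)).
rewrite /= !(hornerM, horner_exp) hornerXsubC subrr expr0n mulr0 mul0r => /esym/eqP.
rewrite !mulf_eq0 -[l.[a] == 0]/(root l a) -[x.[a] == 0]/(root x a).
by rewrite (negPf xa) (negPf la).
Qed.

End Poles.

(** * Jacobi's identity for complementary minors *)

Section Jacobi.
Variable R : comNzRingType.

Lemma det_mxsub_bij n m (h : 'I_n -> 'I_m) (M : 'M[R]_m) :
  bijective h -> \det (mxsub h h M) = \det M.
Proof.
move=> hb; have nm : n = m by have := bij_eq_card hb; rewrite !card_ord.
case: _ / nm in M h hb *.
pose s := perm (bij_inj hb).
have -> : mxsub h h M = row_perm s (col_perm s M).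
  by apply/matrixP=> i j; rewrite !mxE !permE.
rewrite row_permE col_permE !det_mulmx !det_perm odd_permV mulrC -mulrA.
by rewrite -signr_addb addbb mulr1.
Qed.

(** Replacing the last q columns of B by columns of the identity turns
M B = c I into a factorization of a block triangular matrix with diagonal
blocks c I and the lower right block of M; take determinants. *)
Lemma jacobi_block p q (M B : 'M[R]_(p + q)) c : M *m B = c%:M ->
  \det M * \det (ulsubmx B) = c ^+ p * \det (drsubmx M).
Proof.
move=> MB; pose N := block_mx (ulsubmx B) 0 (dlsubmx B) 1%:M.
have : M *m N = block_mx c%:M (ursubmx M) 0 (drsubmx M).
  move: MB; rewrite -{1 2}[M]submxK -{1}[B]submxK /N !mulmx_block.
  rewrite -scalemx1 scalar_mx_block scale_block_mx !scaler0 !scalemx1.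
  case/eq_block_mx => -> _ -> _.
  by rewrite !mulmx0 !mulmx1 !add0r.
move/(congr1 determinant).
by rewrite det_mulmx det_lblock det_ublock det1 mulr1 det_scalar.
Qed.

Lemma jacobi_mxsub m p q (h : 'I_(p + q) -> 'I_m) (M B : 'M[R]_m) c :
    bijective h -> M *m B = c%:M ->
  \det M * \det (mxsub (h \o lshift q) (h \o lshift q) B) =
  c ^+ p * \det (mxsub (h \o @rshift p q) (h \o @rshift p q) M).
Proof.
move=> hb MB.
have hMB : mxsub h h M *m mxsub h h B = c%:M.
  apply/matrixP=> i j; rewrite !mxE.
  have /matrixP/(_ (h i) (h j)) := MB.
  rewrite !mxE (inj_eq (bij_inj hb)) => <-.
  rewrite [RHS](reindex h) /=; last exact: onW_bij.
  by apply: eq_bigr => k _; rewrite !mxE.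
have := jacobi_block hMB; rewrite det_mxsub_bij // => e.
have -> : mxsub (h \o lshift q) (h \o lshift q) B = ulsubmx (mxsub h h B).
  by apply/matrixP=> i j; rewrite !mxE.
by rewrite e; congr (_ * \det _); apply/matrixP=> i j; rewrite !mxE.
Qed.

(** The injection f fixes an ordering of S, so that for explicit small S the
minor on S becomes an explicit expression in the entries of B; the
complementary minor keeps the enumeration used by [char_poly_del]. *)
Lemma jacobi_compl m p (f : 'I_p -> 'I_m) (S : {set 'I_m}) (M B : 'M[R]_m) c :
    injective f -> S = [set f i | i : 'I_p] -> M *m B = c%:M ->
  \det M * \det (mxsub f f B) =
  c ^+ p * \det (mxsub (@enum_val _ (mem (~: S))) (@enum_val _ (mem (~: S))) M).
Proof.
move=> fi SE MB; pose g := @enum_val _ (mem (~: S)).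
pose h (i : 'I_(p + #|~: S|)) := match split i with inl x => f x | inr y => g y end.
have hl : h \o lshift _ =1 f by move=> i; rewrite /h /= (unsplitK (inl i)).
have hr : h \o @rshift _ _ =1 g by move=> i; rewrite /h /= (unsplitK (inr i)).
have fS i : f i \in S by rewrite SE imset_f.
have gS i : g i \notin S by have := enum_valP i; rewrite inE.
have hi : injective h.
  move=> i j; rewrite -[i]splitK -[j]splitK /h !unsplitK.
  case: (split i) (split j) => x [] y /=; first by move/fi->.
  - by move=> e; have := gS y; rewrite -e fS.
  - by move=> e; have := gS x; rewrite e fS.
  - by move/enum_val_inj->.
have hb : bijective h.
  apply: inj_card_bij hi _; rewrite !card_ord -{1}(card_ord m) -(cardsC S).
  by rewrite SE card_imset // card_ord.
have e := jacobi_mxsub hb MB.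
have -> : mxsub f f B = mxsub (h \o lshift _) (h \o lshift _) B.
  by apply/matrixP=> i j; rewrite mxE [RHS]mxE !hl.
by rewrite e; congr (_ * \det _); apply/matrixP=> i j; rewrite mxE [RHS]mxE !hr.
Qed.

Lemma det_mx22 (A : 'M[R]_2) : \det A = A 0 0 * A 1 1 - A 0 1 * A 1 0.
Proof.
rewrite (expand_det_row A 0) !big_ord_recl big_ord0 addr0 /cofactor !det_mx11.
rewrite !mxE /= expr0 expr1 mul1r mulN1r mulrN.
by congr (A 0 _ * A _ _ - A 0 _ * A _ _); apply/val_inj.
Qed.

Lemma jacobi_compl1 m (M B : 'M[R]_m) c u : M *m B = c%:M ->
  \det M * B u u =
  c * \det (mxsub (@enum_val _ (mem (~: [set u]))) (@enum_val _ (mem (~: [set u]))) M).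
Proof.
move=> MB; have := @jacobi_compl m 1 (fun=> u) [set u] M B c _ _ MB.
rewrite expr1 => <-.
- by congr (_ * _); rewrite [X in \det X]mx11_scalar det_scalar1 mxE.
- by move=> i j _; rewrite !ord1.
- apply/setP=> x; rewrite !inE; apply/eqP/imsetP => [-> | [_ _ ->]] //.
  by exists ord0.
Qed.

Lemma jacobi_compl2 m (M B : 'M[R]_m) c u v : u != v -> M *m B = c%:M ->
  \det M * (B u u * B v v - B u v * B v u) =
  c ^+ 2 * \det (mxsub (@enum_val _ (mem (~: [set u; v])))
                       (@enum_val _ (mem (~: [set u; v]))) M).
Proof.
move=> uv MB; pose f (i : 'I_2) := if i == 0 then u else v.
rewrite -(@jacobi_compl m 2 f [set u; v] M B c) //.
- by congr (_ * _); rewrite det_mx22 !mxE.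
- move=> i j; rewrite /f => e; apply/val_inj.
  move: e; case: i => [[|[|//]] ?]; case: j => [[|[|//]] ?] //= /eqP.
    by rewrite (negPf uv).
  by rewrite eq_sym (negPf uv).
- apply/setP=> x; rewrite !inE; apply/orP/imsetP => [[]/eqP-> | [i _ ->]].
  + by exists 0.
  + by exists 1.
  + by rewrite /f; case: ifP; [left | right].
Qed.

End Jacobi.

(** * Hermitian idempotents and eigenprojections *)

Section Projections.
Variables (C : numClosedFieldType) (m : nat).
Implicit Types (H E : 'M[C]_m) (a b : C) (u v : 'I_m).

Lemma hermsymmxE E i j : E \is hermsymmx -> E i j = (E j i)^*.
Proof.
by move/is_hermitianmxP/matrixP/(_ i j); rewrite expr0 scale1r !mxE.
Qed.

(** For a Hermitian idempotent, E = E^* E is the Gram matrix of its own columns;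
this is the diagonal entry. *)
Lemma hermsym_idem_norm E u : E \is hermsymmx -> E *m E = E ->
  E u u = \sum_i `|E i u| ^+ 2.
Proof.
move=> Eh Ei; rewrite -{1}Ei mxE; apply: eq_bigr => i _.
by rewrite normCK (hermsymmxE u i Eh) mulrC.
Qed.

Lemma hermsym_idem_diag0 E u : E \is hermsymmx -> E *m E = E ->
  E u u = 0 -> forall i, E i u = 0.
Proof.
move=> Eh Ei; rewrite hermsym_idem_norm // => /eqP.
rewrite psumr_eq0 => [/allP h i | i _]; last exact: exprn_ge0.
by have := h i (mem_index_enum _); rewrite /= expf_eq0 normr_eq0 => /eqP.
Qed.

Lemma mulmx_delta_eqP E u v c :
  E *m delta_mx u 0 = c *: (E *m delta_mx v 0) :> 'cV[C]_m <->
  forall i, E i u = c * E i v.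
Proof.
rewrite -!colE; split=> [/matrixP e i | e].
  by have := e i 0; rewrite !mxE.
by apply/matrixP=> i j; rewrite !mxE.
Qed.

(** Equality in Cauchy-Schwarz for columns u and v of E, whose Gram matrix is E:
expanding the squared length of E_u - c E_v, with c = E_vu / E_vv, gives zero.
If the common length is zero, both columns vanish and c = 1 serves. *)
Lemma hermsym_idem_cauchy E u v : E \is hermsymmx -> E *m E = E ->
    E u u = E v v -> E u u * E v v = E u v * E v u ->
  exists2 c : C, `|c| = 1 & forall i, E i u = c * E i v.
Proof.
move=> Eh Ei uv d0.
have [r0 | r0] := eqVneq (E v v) 0.
  exists 1 => [|i]; first exact: normr1.
  rewrite (hermsym_idem_diag0 Eh Ei r0).
  by rewrite (hermsym_idem_diag0 Eh Ei (etrans uv r0)) mulr0.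
have rR : (E v v)^* = E v v by rewrite -hermsymmxE.
pose c := E v u / E v v.
have cC : c^* = E u v / E v v by rewrite /c rmorphM fmorphV /= rR -hermsymmxE.
have d1 : E u v * E v u = E v v * E v v by rewrite -d0 uv.
exists c => [|i].
  apply/eqP; rewrite -sqrp_eq1 ?normr_ge0 // normCK cC /c.
  by apply/eqP; rewrite mulf_div [E v u * _]mulrC d1 divff ?mulf_neq0.
have : \sum_i `|E i u - c * E i v| ^+ 2 = 0.
  (* The Gram property of E. *)
  have S x y : \sum_i (E i x)^* * E i y = E x y.
    by rewrite -{3}Ei mxE; apply: eq_bigr => k _; rewrite -hermsymmxE.
  transitivity (E u u - c * E u v - c^* * E v u + c * c^* * E v v).
    rewrite -(S u u) -(S u v) -(S v u) -(S v v) !mulr_sumr -!sumrB -big_split /=.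
    by apply: eq_bigr => k _; rewrite normCK rmorphB rmorphM /=; ring.
  rewrite cC /c uv; apply: (mulfI r0); rewrite mulr0.
  transitivity (E v v * E v v - E u v * E v u); last by rewrite d1 subrr.
  by field.
move/eqP; rewrite psumr_eq0 => [/allP h | k _]; last exact: exprn_ge0.
have := h i (mem_index_enum _).
by rewrite /= expf_eq0 normr_eq0 subr_eq0 => /eqP.
Qed.

Lemma mulmx_eigenproj H a : H *m eigenproj H a = a *: eigenproj H a.
Proof.
apply/matrixP=> i j.
have /matrixP/(_ i 0) : H *m col j (eigenproj H a) = a *: col j (eigenproj H a).
  by apply/eigenproj_fixP; rewrite colE mulmxA eigenproj_idem.
by rewrite colE mulmxA -!colE !mxE.
Qed.

(** Eigenvectors for different eigenvalues are orthogonal.  Taking adjoints of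
H E = a E gives E H = conj(a) E, and sandwiching H between two copies of E
gives conj(a) E = a E, so that a is real unless E = 0.  Hence
a E x = E H x = b E x. *)
Lemma eigenproj_orth H a b (x : 'cV[C]_m) : H \is hermsymmx ->
  H *m x = b *: x -> a != b -> eigenproj H a *m x = 0.
Proof.
move=> Hh Hx ab; set E := eigenproj H a.
have ctE (A B : 'M[C]_m) :  A \is hermsymmx -> B \is hermsymmx ->
    forall i j, (A *m B) i j = ((B *m A) j i)^*.
  move=> Ah Bh i j; rewrite !mxE rmorph_sum; apply: eq_bigr => k _ /=.
  by rewrite rmorphM /= -!hermsymmxE // mulrC.
have Eh : E \is hermsymmx := eigenproj_hermsym H a.
have HE : H *m E = a *: E := mulmx_eigenproj H a.
have EH : E *m H = a^* *: E.
  by apply/matrixP=> i j; rewrite ctE // HE mxE [RHS]mxE rmorphM /= -hermsymmxE.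
have EHE : a^* *: E = a *: E.
  have EE : E *m E = E := eigenproj_idem H a.
  by rewrite -[in LHS]EE scalemxAl -EH -mulmxA HE -scalemxAr EE.
have : a *: (E *m x) = b *: (E *m x).
  by rewrite scalemxAl -EHE -EH -mulmxA Hx scalemxAr.
move/eqP; rewrite -subr_eq0 -scalerBl scaler_eq0 subr_eq0 (negPf ab) /=.
by move/eqP.
Qed.

Lemma eigenvalue_enum H :
  exists2 s : seq C, uniq s & forall a, (a \in s) = eigenvalue H a.
Proof.
have [r rE] := closed_field_poly_normal (char_poly H).
exists (undup r) => [|a]; first exact: undup_uniq.
rewrite mem_undup eigenvalue_root_char rE (monicP (char_poly_monic H)) scale1r.
by rewrite root_prod_XsubC.
Qed.

(** The spectral theorem in projection form.  A unitary diagonalization of H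
supplies a basis of eigenvectors, the columns of the inverse of P; the
projection for the eigenvalue of such a column fixes it and all the others
kill it, so the sum acts as the identity on a basis. *)
Lemma sum_eigenproj H (s : seq C) : H \is hermsymmx -> uniq s ->
  (forall a, (a \in s) = eigenvalue H a) -> \sum_(a <- s) eigenproj H a = 1%:M.
Proof.
move=> Hh us sE.
have HE := orthomx_spectralP (hermitian_normalmx Hh).
move: (spectralmx H) (spectral_diag H) (unitarymx_unit (spectral_unitarymx H)) HE.
move=> P d Pu HE.
have HV : H *m invmx P = invmx P *m diag_mx d by rewrite HE mulmxK.
have PH : P *m H = diag_mx d *m P by rewrite HE !mulmxA mulmxV // mul1mx.
have ds k : d 0 k \in s.
  rewrite sE; apply/eigenvalueP; exists (row k P).
    by apply/rowP=> j; rewrite -row_mul PH mul_diag_mx !mxE.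
  apply/eqP=> rk; have /(congr1 (row k)) := mulmxV Pu.
  rewrite row_mul rk mul0mx row1 => /matrixP/(_ 0 k)/eqP.
  by rewrite !mxE !eqxx eq_sym oner_eq0.
suff SV : (\sum_(a <- s) eigenproj H a) *m invmx P = invmx P.
  by rewrite -[LHS](mulmxKV Pu) SV mulVmx.
apply/matrixP=> i k; set V := invmx P.
have Vk : H *m col k V = d 0 k *: col k V.
  rewrite colE mulmxA HV; apply/matrixP=> x y.
  by rewrite -!colE mul_mx_diag !mxE mulrC.
have : (\sum_(a <- s) eigenproj H a) *m col k V = col k V.
  rewrite mulmx_suml (bigD1_seq (d 0 k)) //= big1 ?addr0 => [|b bk].
    exact/eigenproj_fixP.
  exact: eigenproj_orth Hh Vk bk.
by move/matrixP/(_ i 0); rewrite colE mulmxA -!colE !mxE.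
Qed.

End Projections.

(** * The resolvent of a Hermitian matrix *)

Section Resolvent.
Variables (C : numClosedFieldType) (m : nat).
Implicit Types (H : 'M[C]_m) (s : seq C) (a b : C) (u v : 'I_m).

Definition lagrange_num s a : {poly C} := \prod_(b <- s | b != a) ('X - b%:P).

(** Numerator of the partial fraction expansion sum_a E_a / (t - a) of the
resolvent over the squarefree denominator prod_a (t - a).  It need not be the
adjugate: common factors due to multiplicities of eigenvalues are absent. *)
Definition resolvent_num H s : 'M[{poly C}]_m :=
  \sum_(a <- s) lagrange_num s a *: map_mx polyC (eigenproj H a).

Lemma prod_lagrange_num s a : uniq s -> a \in s ->
  \prod_(b <- s) ('X - b%:P) = ('X - a%:P) * lagrange_num s a.
Proof. by move=> us sa; rewrite (bigD1_seq a). Qed.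

Lemma root_lagrange_num s a b : root (lagrange_num s a) b = (b \in s) && (b != a).
Proof.
by rewrite /lagrange_num -big_filter root_prod_XsubC mem_filter andbC.
Qed.

Lemma resolvent_numE H s u v : resolvent_num H s u v =
  \sum_(a <- s) lagrange_num s a * (eigenproj H a u v)%:P.
Proof.
by rewrite summxE; apply: eq_bigr => a _; rewrite !mxE.
Qed.

(** Since (tI - H) E_a = (t - a) E_a, each term contributes psi E_a, where psi
is the product of all t - a, and the E_a sum to the identity. *)
Lemma mul_char_poly_resolvent H s : H \is hermsymmx -> uniq s ->
    (forall a, (a \in s) = eigenvalue H a) ->
  char_poly_mx H *m resolvent_num H s = (\prod_(a <- s) ('X - a%:P))%:M.
Proof.
move=> Hh us sE; rewrite mulmx_sumr.
transitivity (\sum_(a <- s)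
    (\prod_(b <- s) ('X - b%:P)) *: map_mx polyC (eigenproj H a)).
  rewrite big_seq [RHS]big_seq; apply: eq_bigr => a sa.
  rewrite (prod_lagrange_num us sa) -scalemxAr mulrC -scalerA; congr (_ *: _).
  rewrite mulmxBl mul_scalar_mx -map_mxM mulmx_eigenproj scalerBl.
  by rewrite map_mxZ.
by rewrite -scaler_sumr -map_mx_sum sum_eigenproj // map_scalar_mx scalemx1.
Qed.

(** Evaluating at an eigenvalue isolates its projection, because every other
term has t - a as a factor. *)
Lemma horner_resolvent_num H s a u v : uniq s -> a \in s ->
  (resolvent_num H s u v).[a] = (lagrange_num s a).[a] * eigenproj H a u v.
Proof.
move=> us sa; rewrite resolvent_numE horner_sum (bigD1_seq a) //= big1 ?addr0.
  by rewrite hornerM hornerC.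
move=> b ba; rewrite hornerM; have /eqP-> : root (lagrange_num s b) a.
  by rewrite root_lagrange_num sa eq_sym.
by rewrite mul0r.
Qed.

End Resolvent.

(** * Deleted characteristic polynomials and eigenprojections *)

Section Deletion.
Variables (C : numClosedFieldType) (m : nat) (H : 'M[C]_m) (s : seq C).
Variables (u v : 'I_m).
Hypotheses (Hh : H \is hermsymmx) (us : uniq s).
Hypothesis sE : forall a, (a \in s) = eigenvalue H a.

Lemma horner_lagrange_neq0 a : a \in s -> (lagrange_num s a).[a] != 0.
Proof.
move=> sa; apply/negP; rewrite -[_ == 0]/(root _ _) root_lagrange_num eqxx.
by rewrite andbF.
Qed.

(** phi_u / phi is the diagonal entry sum_a (E_a)_uu / (t - a) of the resolvent,
which determines its residues (E_a)_uu and is determined by them. *)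
Lemma char_poly_del1_eqP :
  char_poly_del H [set u] = char_poly_del H [set v] <-> cospectral H u v.
Proof.
have MB := mul_char_poly_resolvent Hh us sE.
have psi0 : \prod_(a <- s) ('X - a%:P) != 0 by rewrite monic_neq0 ?monic_prod_XsubC.
have phi0 : char_poly H != 0 by rewrite monic_neq0 ?char_poly_monic.
have Ju := jacobi_compl1 u MB; have Jv := jacobi_compl1 v MB.
split=> [e a ea | co].
  have sa : a \in s by rewrite sE.
  apply: (mulfI (horner_lagrange_neq0 sa)).
  rewrite -!horner_resolvent_num //; congr (_.[a]).
  by apply: (mulfI phi0); rewrite Ju Jv; congr (_ * _).
apply: (mulfI psi0); rewrite -Ju -Jv !resolvent_numE; congr (_ * _).
rewrite !big_seq; apply: eq_bigr => a sa; rewrite co //.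
by rewrite -sE.
Qed.

(** phi_{u,v} / phi is a 2 x 2 minor of the resolvent, and the corresponding
minor of E_a is the coefficient of its 1 / (t - a)^2 term. *)
Lemma simple_poles_del2P : u != v ->
  simple_poles (tofrac (char_poly_del H [set u; v]) / tofrac (char_poly H)) <->
  forall a, eigenvalue H a ->
    eigenproj H a u u * eigenproj H a v v = eigenproj H a u v * eigenproj H a v u.
Proof.
move=> uv; have MB := mul_char_poly_resolvent Hh us sE.
have phi0 : char_poly H != 0 by rewrite monic_neq0 ?char_poly_monic.
have psi0 : \prod_(a <- s) ('X - a%:P) != 0 by rewrite monic_neq0 ?monic_prod_XsubC.
have sqf a : root (\prod_(a <- s) ('X - a%:P)) a ->
    exists2 l, \prod_(a <- s) ('X - a%:P) = ('X - a%:P) * l & ~~ root l a.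
  rewrite root_prod_XsubC => sa; exists (lagrange_num s a).
    exact: prod_lagrange_num.
  exact: horner_lagrange_neq0.
apply: (iff_trans (simple_poles_over_sqrP phi0 psi0 (jacobi_compl2 uv MB) sqf)).
have rE a : a \in s ->
  root (resolvent_num H s u u * resolvent_num H s v v
        - resolvent_num H s u v * resolvent_num H s v u) a =
  (eigenproj H a u u * eigenproj H a v v
   == eigenproj H a u v * eigenproj H a v u).
  move=> sa; rewrite /root hornerD hornerN !hornerM !horner_resolvent_num //.
  move: (horner_lagrange_neq0 sa) (eigenproj H a) => l0 E.
  move: (lagrange_num s a).[a] l0 => l l0.
  rewrite subr_eq0 (mulrACA l (E u u)) (mulrACA l (E u v)) (inj_eq (mulfI _)) //.
  by rewrite mulf_neq0.
split=> h a; first by rewrite -sE => sa; apply/eqP; rewrite -rE // h ?root_prod_XsubC.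
by rewrite root_prod_XsubC => sa; rewrite rE // h // -sE.
Qed.

End Deletion.

Theorem theorem3p1 (C : numClosedFieldType) (m : nat) (H : 'M[C]_m)
    (u v : 'I_m) (hH : H \is hermsymmx) (huv : u != v) :
  [<-> strongly_cospectral H u v;
       cospectral H u v /\ parallel H u v;
       char_poly_del H [set u] = char_poly_del H [set v] /\
       simple_poles (tofrac (char_poly_del H [set u; v]) / tofrac (char_poly H))].
Proof.
have [s us sE] := eigenvalue_enum H.
have Eh a : eigenproj H a \is hermsymmx := eigenproj_hermsym H a.
have EE a := eigenproj_idem H a.
tfae.
- move=> sc; split=> a ea; have [c c1 cE] := sc a ea; last by exists c.
  have {}cE := (mulmx_delta_eqP _ _ _ _).1 cE.
  rewrite !(hermsym_idem_norm _ (Eh a) (EE a)); apply: eq_bigr => i _.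
  by rewrite cE normrM c1 mul1r.
- case=> co pa; split; first exact/(char_poly_del1_eqP _ _ hH us sE).
  apply/(simple_poles_del2P hH us sE huv) => a ea.
  have [c /mulmx_delta_eqP cE] := pa a ea.
  by rewrite !cE; ring.
- case=> /(char_poly_del1_eqP _ _ hH us sE) co.
  move=> /(simple_poles_del2P hH us sE huv) d0 a ea.
  have [c c1 cE] := hermsym_idem_cauchy (Eh a) (EE a) (co a ea) (d0 a ea).
  by exists c => //; apply/mulmx_delta_eqP.
Qed.
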